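(* Branch-awareness is decidable on languages accepted by c-automata: there is an algorithm that, given a c-automaton $\mathcal{A}$, decides whether $\mathbf{L}(\mathcal{A})$ is branch-aware.
   Context: Fix disjoint sets $\mathfrak{P}$ (participants) and $\mathfrak{M}$ (messages); interactions $\Sigma_{int}=\{A\to B{:}m\mid A\neq B\}$. An FSA $\langle\mathcal{S},q_0,\mathcal{L},\to\rangle$ has finitely many states, initial state, finitely many labels and transitions; all states are accepting and its language $\mathbf{L}$ consists of finite words labelling finite paths from $q_0$ and infinite words labelling infinite paths from $q_0$. A c-automaton is a deterministic FSA labelled in $\Sigma_{int}$. Projection: $(A\to B{:}m){\upharpoonright}_A=AB!m$, $(A\to B{:}m){\upharpoonright}_B=AB?m$, $\varepsilon$ for other participants, extended homomorphically to finite and infinite words. A word $z$ is maximal in a language $L$ if $z\preceq z'\in L$ implies $z'=z$ ($\preceq$: prefix order, $\prec$: strict prefix). A participant $X$ distinguishes interaction words $w_1,w_2$ if $w_1{\upharpoonright}_X\neq w_2{\upharpoonright}_X$, $w_1{\upharpoonright}_X\not\prec w_2{\upharpoonright}_X$ and $w_2{\upharpoonright}_X\not\prec w_1{\upharpoonright}_X$. A language $\mathcal{L}$ with participant set $P$ is branch-aware if each $X\in P$ distinguishes all pairs of maximal words in $\mathcal{L}$ whose projections on $X$ differ. *)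

(* Defs.v *)
From HB Require Import structures.
From mathcomp Require Import all_boot.
From mathcomp Require Import boolp.

Set Implicit Arguments.
Unset Strict Implicit.
Unset Printing Implicit Defensive.

(** * Finite and infinite words *)

Inductive word (T : Type) : Type :=
| Fin of seq T
| Inf of (nat -> T).

Definition wat (T : Type) (w : word T) (n : nat) : option T :=
  match w with
  | Fin s => onth s n
  | Inf u => Some (u n)
  end.

Definition wprefix (T : Type) (u v : word T) : Prop :=
  forall n a, wat u n = Some a -> wat v n = Some a.

Definition wsprefix (T : Type) (u v : word T) : Prop :=
  wprefix u v /\ u <> v.

Lemma onth_lt (T : Type) (s : seq T) n a : onth s n = Some a -> n < size s.
Proof. by rewrite -onthTE => ->. Qed.

Lemma wprefix_trans (T : Type) (u v w : word T) :
  wprefix u v -> wprefix v w -> wprefix u w.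
Proof. by move=> uv vw n a /uv /vw. Qed.

Lemma wprefix_anti (T : Type) (u v : word T) :
  wprefix u v -> wprefix v u -> u = v.
Proof.
have nFI (s : seq T) (w : nat -> T) : ~ wprefix (Inf w) (Fin s).
  by move=> H; have := onth_lt (H (size s) (w (size s)) erefl); rewrite ltnn.
case: u v => [s|u] [t|v] uv vu //.
- congr Fin; elim: s t uv vu => [|a s IHs] [|b t] // uv vu.
  + by have := vu 0 b erefl.
  + by have := uv 0 a erefl.
  + have /= [->] := uv 0 a erefl; congr cons; apply: IHs => n c H.
    * exact: (uv n.+1 c H).
    * exact: (vu n.+1 c H).
- by case: (nFI s v).
- by case: (nFI t u).
- by congr Inf; apply/funext => n; have [] := uv n _ erefl.
Qed.

Definition is_wlub (T : Type) (c : nat -> seq T) (u : word T) : Prop :=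
  (forall n, wprefix (Fin (c n)) u) /\
  (forall v, (forall n, wprefix (Fin (c n)) v) -> wprefix u v).

Lemma wlub_exists (T : Type) (c : nat -> seq T) :
  (forall n, wprefix (Fin (c n)) (Fin (c n.+1))) -> exists u, is_wlub c u.
Proof.
move=> cS.
have cle m n : m <= n -> wprefix (Fin (c m)) (Fin (c n)).
  elim: n => [|n IHn]; first by rewrite leqn0 => /eqP->.
  rewrite leq_eqVlt ltnS => /predU1P[->//|/IHn mn].
  exact: wprefix_trans mn (cS n).
have [unb|/existsNP[k bnd]] := pselect (forall k, exists n, k < size (c n)).
  have /choice[u uP] : forall k, exists a, exists n, onth (c n) k = Some a.
    move=> k; have [n] := unb k; rewrite -onthTE.
    by case E: (onth (c n) k) => [a|//] _; exists a, n.
  exists (Inf u); split=> [n k a /= cnk | v vP k a /= [<-]].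
    have [m cmk] := uP k.
    have /= := cle _ _ (leq_maxl n m) _ _ cnk.
    have /= -> := cle _ _ (leq_maxr n m) _ _ cmk.
    by case=> ->.
  by have [n cnk] := uP k; exact: vP cnk.
have bndP n : size (c n) <= k.
  by rewrite leqNgt; apply/negP => H; apply: bnd; exists n.
pose reached j := `[< exists n, size (c n) = j >].
have ex0 : exists j, reached j by exists (size (c 0)); apply/asboolP; exists 0.
have ub j : reached j -> j <= k by move=> /asboolP[n <-].
have [_ /asboolP[n <-] nmax] := ex_maxnP ex0 ub.
exists (Fin (c n)); split=> [m i a cmi|v]; last exact.
have /= cMi := cle _ _ (leq_maxl m n) _ _ cmi.
have lt_i : i < size (c n).
  apply: leq_trans (onth_lt cMi) _; apply: nmax; apply/asboolP.
  by exists (maxn m n).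
move: lt_i; rewrite -onthTE /=; case E: (onth (c n) i) => [b|//] _.
by have /= := cle _ _ (leq_maxr m n) _ _ E; rewrite cMi.
Qed.

Lemma pmap_mkseqS (A B : Type) (f : A -> option B) (u : nat -> A) n :
  wprefix (Fin (pmap f (mkseq u n))) (Fin (pmap f (mkseq u n.+1))).
Proof.
rewrite mkseqS -cats1 pmap_cat => i a H.
by move: H (onth_lt H) => /= H lt_i; rewrite onth_cat lt_i.
Qed.

(** The homomorphism induced by a letter map [f], where [f a = None] means that
    [a] is mapped to the empty word.  On an infinite word it is the limit of the
    images of the finite prefixes, which may itself be finite. *)
Definition whom (A B : Type) (f : A -> option B) (w : word A) : word B :=
  match w with
  | Fin s => Fin (pmap f s)
  | Inf u => sval (cid (wlub_exists (fun n => @pmap_mkseqS A B f u n)))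
  end.

(** * Interactions, projections, branch-awareness *)

(** [P] is the type of participants and [M] the type of messages; as distinct
    types they are disjoint. *)
Definition interaction (P M : eqType) : eqType :=
  {i : P * P * M | i.1.1 != i.1.2}.

Definition sender (P M : eqType) (i : interaction P M) : P := (val i).1.1.
Definition receiver (P M : eqType) (i : interaction P M) : P := (val i).1.2.
Definition message (P M : eqType) (i : interaction P M) : M := (val i).2.

Inductive action (P M : Type) : Type :=
| Send of P & P & M  (* AB!m *)
| Recv of P & P & M  (* AB?m *).

Definition proj_int (P M : eqType) (X : P) (i : interaction P M) :
    option (action P M) :=
  if X == sender i then Some (Send (sender i) (receiver i) (message i))
  else if X == receiver i then Some (Recv (sender i) (receiver i) (message i))
  else None.

Definition proj (P M : eqType) (X : P) (w : word (interaction P M)) :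
    word (action P M) :=
  whom (proj_int X) w.

Definition language (T : Type) : Type := word T -> Prop.

Definition maximal (T : Type) (L : language T) (z : word T) : Prop :=
  forall z', L z' -> wprefix z z' -> z' = z.

Definition distinguishes (P M : eqType) (X : P)
    (w1 w2 : word (interaction P M)) : Prop :=
  [/\ proj X w1 <> proj X w2,
      ~ wsprefix (proj X w1) (proj X w2)
    & ~ wsprefix (proj X w2) (proj X w1)].

Definition participant_of (P M : eqType) (L : language (interaction P M))
    (X : P) : Prop :=
  exists w n i, [/\ L w, wat w n = Some i & X = sender i \/ X = receiver i].

Definition branch_aware (P M : eqType) (L : language (interaction P M)) :
    Prop :=
  forall X, participant_of L X ->
  forall w1 w2, L w1 -> maximal L w1 -> L w2 -> maximal L w2 ->
  proj X w1 <> proj X w2 -> distinguishes X w1 w2.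

(** * Automata *)

Record fsa (Lab : eqType) : Type := FSA {
  fsa_state : finType;
  fsa_init : fsa_state;
  fsa_labels : seq Lab;
  fsa_trans : seq (fsa_state * Lab * fsa_state);
  fsa_transP : forall q a q', (q, a, q') \in fsa_trans -> a \in fsa_labels }.

Definition lang (Lab : eqType) (A : fsa Lab) : language Lab := fun w =>
  exists r : nat -> fsa_state A,
    r 0 = fsa_init A /\
    forall n a, wat w n = Some a -> (r n, a, r n.+1) \in fsa_trans A.

Definition deterministic (Lab : eqType) (A : fsa Lab) : Prop :=
  forall q a q1 q2,
    (q, a, q1) \in fsa_trans A -> (q, a, q2) \in fsa_trans A -> q1 = q2.

Record c_automaton (P M : eqType) : Type := CAutomaton {
  c_fsa :> fsa (interaction P M);
  c_det : deterministic c_fsa }.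

(** * Partial recursive functions *)

(** The mu-recursive functions of arity [n]. *)
Inductive recf : nat -> Type :=
| Zero n : recf n
| Succ : recf 1
| Proj n (i : 'I_n) : recf n
| Comp n k (f : recf k) (g : 'I_k -> recf n) : recf n
| Prec n (f : recf n) (g : recf n.+2) : recf n.+1
| Mu n (f : recf n.+1) : recf n.

(** [reval f v y]: the partial function denoted by [f] is defined at [v], with
    value [y].  Primitive recursion is on the first argument:
    [h (0, v) = f v] and [h (i + 1, v) = g (i, h (i, v), v)]. *)
Fixpoint reval n (f : recf n) : n.-tuple nat -> nat -> Prop :=
  match f in recf n return n.-tuple nat -> nat -> Prop with
  | Zero _ => fun _ y => y = 0
  | Succ => fun v y => y = (thead v).+1
  | Proj _ i => fun v y => y = tnth v i
  | Comp _ k f g => fun v y =>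
      exists u : k.-tuple nat,
        (forall i, reval (g i) v (tnth u i)) /\ reval f u y
  | Prec n f g => fun v y =>
      exists h : nat -> nat,
        [/\ reval f [tuple of behead v] (h 0),
            forall i, i < thead v ->
              reval g [tuple of i :: h i :: behead v] (h i.+1)
          & y = h (thead v)]
  | Mu _ f => fun v y =>
      reval f [tuple of y :: v] 0 /\
      forall i, i < y -> exists z, reval f [tuple of i :: v] z.+1
  end.

Lemma reval_fun n (f : recf n) v y1 y2 :
  reval f v y1 -> reval f v y2 -> y1 = y2.
Proof.
elim: f v y1 y2 => {n} [n||n i|n k f IHf g IHg|n f IHf g IHg|n f IHf] v y1 y2 /=.
- by move=> -> ->.
- by move=> -> ->.
- by move=> -> ->.
- move=> [u1 [g1 f1]] [u2 [g2 f2]].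
  have u12 : u1 = u2 by apply: eq_from_tnth => i; exact: IHg (g1 i) (g2 i).
  by rewrite u12 in f1; exact: IHf f1 f2.
- move=> [h1 [f1 g1 ->]] [h2 [f2 g2 ->]].
  have h12 i : i <= thead v -> h1 i = h2 i.
    elim: i => [_|i IHi lt_i]; first exact: IHf f1 f2.
    have g1i := g1 i lt_i; rewrite (IHi (ltnW lt_i)) in g1i.
    exact: IHg g1i (g2 i lt_i).
  exact: h12.
- move=> [z1 m1] [z2 m2]; case: (ltngtP y1 y2) => // lt_y.
  + by have [z /IHf/(_ z1)] := m2 _ lt_y.
  + by have [z /IHf/(_ z2)] := m1 _ lt_y.
Qed.

(** [D] is decided, on inputs of type [I] presented by the numbers related to
    them by [repr], by an algorithm that halts on every presentation of every
    input. *)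
Definition algorithmically_decidable (I : Type) (repr : I -> nat -> Prop)
    (D : I -> Prop) : Prop :=
  exists f : recf 1, forall x c, repr x c ->
    (D x -> reval f [tuple c] 1) /\ (~ D x -> reval f [tuple c] 0).

(** * Finite presentations of c-automata *)

(** States, participants and messages are abstract, so an automaton is given to
    an algorithm by naming with numbers those that it mentions, distinct ones
    receiving distinct names, and listing its components; [CodeSeq.code] is the
    bijection [seq nat -> nat] of MathComp. *)

Definition fsa_participants (P M : eqType) (A : fsa (interaction P M)) :
    seq P :=
  [seq sender i | i <- fsa_labels A] ++ [seq receiver i | i <- fsa_labels A].

Definition fsa_messages (P M : eqType) (A : fsa (interaction P M)) : seq M :=
  [seq message i | i <- fsa_labels A].

Definition interaction_code (P M : eqType) (nP : P -> nat) (nM : M -> nat)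
    (i : interaction P M) : nat :=
  CodeSeq.code [:: nP (sender i); nP (receiver i); nM (message i)].

Definition fsa_code (P M : eqType) (A : fsa (interaction P M))
    (nQ : fsa_state A -> nat) (nP : P -> nat) (nM : M -> nat) : nat :=
  CodeSeq.code
    [:: CodeSeq.code [seq nQ q | q <- enum (fsa_state A)];
        nQ (fsa_init A);
        CodeSeq.code [seq interaction_code nP nM i | i <- fsa_labels A];
        CodeSeq.code
          [seq CodeSeq.code
                 [:: nQ t.1.1; interaction_code nP nM t.1.2; nQ t.2]
          | t <- fsa_trans A]].

Definition presented_by (P M : eqType) (A : c_automaton P M) (c : nat) : Prop :=
  exists (nQ : fsa_state A -> nat) (nP : P -> nat) (nM : M -> nat),
    [/\ injective nQ,
        {in fsa_participants A &, injective nP},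
        {in fsa_messages A &, injective nM}
      & c = fsa_code nQ nP nM].

(* Main.v *)
Require Import Defs.
From mathcomp Require Import all_boot.
From mathcomp Require Import boolp.

(** A maximal word of a deterministic automaton is an infinite one or one ending
    in a dead state.  Hence branch-awareness fails exactly when, for some [X],
    two words with the same projection on [X] lead from the initial state to
    [q1] and [q2], where [q1] has a maximal run on which [X] does nothing and
    [q2] has a transition involving [X]: the first word is then completed so that
    its projection is a strict prefix of that of a completion of the second.
    The reachable pairs [(q1, q2)], and the states without a maximal run silent
    for [X], are least fixed points of monotone operators on finite sets; they
    are computed by iteration, a primitive recursive process on coded lists. *)

Set Implicit Arguments.
Unset Strict Implicit.
Unset Printing Implicit Defensive.

(** * Recursive functions of coded lists *)

(* Arguments are read from a list of length [k] rather than from a tuple, so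
   that binders are de Bruijn style: [head 0 v] is the innermost variable and
   [behead v] the enclosing context. *)
Definition comp k (F : seq nat -> nat) : Prop :=
  exists f : recf k, forall v : k.-tuple nat, reval f v (F v).

Lemma comp_ext k F G :
  (forall v, size v = k -> F v = G v) -> comp k F -> comp k G.
Proof.
by move=> FG [f fP]; exists f => v; rewrite -FG ?size_tuple //; exact: fP.
Qed.

Lemma comp_nth k i : i < k -> comp k (fun v => nth 0 v i).
Proof.
move=> lt_i; exists (Proj (Ordinal lt_i)) => v /=.
by rewrite (tnth_nth 0).
Qed.

Lemma comp_subst m k F (G : nat -> seq nat -> nat) :
  comp m F -> (forall i, i < m -> comp k (G i)) ->
  comp k (fun v => F (mkseq (G^~ v) m)).
Proof.
move=> [f fP] GP.
have /choice[g gP] (i : 'I_m) :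
    exists g : recf k, forall v : k.-tuple nat, reval g v (G i v).
  by have [g ?] := GP i (ltn_ord i); exists g.
exists (Comp f g) => v /=.
have sz : size (mkseq (G^~ v) m) == m by rewrite size_mkseq.
exists (Tuple sz); split; last exact: fP (Tuple sz).
by move=> i; rewrite (tnth_nth 0) /= nth_mkseq.
Qed.

(** Composition with [a] in front of all the projections; in the de Bruijn reading of contexts it is
    a let binding. *)
Lemma comp_let k F a :
  comp k.+1 F -> comp k a -> comp k (fun v => F (a v :: v)).
Proof.
move=> cF ca; pose G i := if i is j.+1 then nth 0 ^~ j else a.
apply: (@comp_ext k (fun v => F (mkseq (G^~ v) k.+1))) => [v sz|].
  congr F; apply: (@eq_from_nth _ 0) => [|i]; rewrite size_mkseq /= ?sz //.
  by move=> lt_i; rewrite nth_mkseq //; case: i lt_i.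
by apply: comp_subst => // -[|i] lt_i; rewrite /G //; exact: comp_nth.
Qed.

Lemma comp_weak k F : comp k F -> comp k.+1 (fun v => F (behead v)).
Proof.
move=> cF; apply: (@comp_ext _ (fun v => F (mkseq (fun i => nth 0 v i.+1) k))).
  move=> v sz; congr F; apply: (@eq_from_nth _ 0) => [|i].
    by rewrite size_mkseq size_behead sz.
  by rewrite size_mkseq => lt_i; rewrite nth_mkseq // nth_behead.
by apply: (comp_subst (G := fun i v => nth 0 v i.+1)) cF _ => i lt_i; exact: comp_nth.
Qed.

(** Weakening at depth [p]. With [p = 1] it lets the body of a loop ignore an accumulator or a
    counter lying just under the innermost variable. *)
Lemma comp_skip k p F :
  p <= k -> comp k F -> comp k.+1 (fun v => F (take p v ++ drop p.+1 v)).
Proof.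
move=> le_p cF; pose G i (v : seq nat) := nth 0 v (bump p i).
apply: (@comp_ext _ (fun v => F (mkseq (G^~ v) k))) => [v sz|].
  have lt_p : p < size v by rewrite sz.
  congr F; apply: (@eq_from_nth _ 0) => [|i]; rewrite size_mkseq.
    by rewrite size_cat size_takel ?(ltnW lt_p) // size_drop sz subSS subnKC.
  move=> lt_i; rewrite nth_mkseq // /G nth_cat size_takel ?(ltnW lt_p) // /bump.
  case: ltnP => [lt_ip|le_pi]; first by rewrite nth_take.
  by rewrite nth_drop addSn subnKC.
apply: comp_subst => // i lt_i; apply: comp_nth.
by rewrite /bump; case: (p <= i); [|apply: ltnW].
Qed.

Lemma comp_head k : comp k.+1 (fun v => head 0 v).
Proof.
by apply: (@comp_ext _ (fun v => nth 0 v 0)) => [[]//|]; exact: comp_nth.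
Qed.

Lemma comp_iteri k z (g : seq nat -> nat -> nat -> nat) n :
  comp k n ->
  comp k.+2 (fun v => g (behead (behead v)) (head 0 v) (head 0 (behead v))) ->
  comp k z -> comp k (fun v => iteri (n v) (g v) (z v)).
Proof.
move=> cn [rg gP] [rz zP].
(* [Prec] recurses on its first argument, so the number of rounds becomes a fresh innermost
   variable, which [comp_let] then instantiates by [n]. *)
pose F v := iteri (head 0 v) (g (behead v)) (z (behead v)).
suffices cF : comp k.+1 F by exact: comp_ext (comp_let cF cn).
exists (Prec rz rg) => v; exists (fun i => iteri i (g (behead v)) (z (behead v))).
have tE : thead v = head 0 v by case/tupleP: v => x v; rewrite theadE.
split=> [|i _|]; last by rewrite tE.
- exact: (zP [tuple of behead v]).
- exact: (gP [tuple of i :: iteri i (g (behead v)) (z (behead v)) :: behead v]).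
Qed.

Lemma comp_succ k a : comp k a -> comp k (fun v => (a v).+1).
Proof.
move=> ca; apply: (@comp_ext _ (fun v => (head 0 (mkseq (fun _ => a v) 1)).+1)) => //.
apply: (comp_subst (F := fun w => (head 0 w).+1) (G := fun _ => a)) => //.
by exists Succ => v /=; case/tupleP: v => x v; rewrite theadE.
Qed.

Lemma comp_const k n : comp k (fun _ => n).
Proof. by elim: n => [|n IHn]; [exists (Zero k) | exact: comp_succ IHn]. Qed.

(* [comp_weak] needs its function argument, which higher-order unification would
   not find under several binders. *)
Ltac cvar :=
  solve [ assumption | exact: comp_head | exact: comp_const
  | match goal with
    | |- comp _ (fun v => ?e (behead (behead (behead (behead (behead (behead v))))))) =>
      apply: (comp_weak
        (F := fun w => e (behead (behead (behead (behead (behead w)))))))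
    | |- comp _ (fun v => ?e (behead (behead (behead (behead (behead v)))))) =>
      apply: (comp_weak (F := fun w => e (behead (behead (behead (behead w))))))
    | |- comp _ (fun v => ?e (behead (behead (behead (behead v))))) =>
      apply: (comp_weak (F := fun w => e (behead (behead (behead w)))))
    | |- comp _ (fun v => ?e (behead (behead (behead v)))) =>
      apply: (comp_weak (F := fun w => e (behead (behead w))))
    | |- comp _ (fun v => ?e (behead (behead v))) =>
      apply: (comp_weak (F := fun w => e (behead w)))
    | |- comp _ (fun v => ?e (behead v)) =>
      apply: (comp_weak (F := e))
    end; cvar ].

(** * Arithmetic and boolean operations, with booleans as 0 and 1 *)

Section Arithmetic.
Variables (k : nat) (a b : seq nat -> nat).
Hypotheses (ca : comp k a) (cb : comp k b).

Lemma comp_add : comp k (fun v => a v + b v).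
Proof.
apply: (@comp_ext _ (fun v => iteri (a v) (fun _ => succn) (b v))).
  by move=> v _; elim: (a v) => //= n ->.
by apply: comp_iteri => //; apply: comp_succ; cvar.
Qed.

Lemma comp_pred : comp k (fun v => (a v).-1).
Proof.
(* The index passed in the last round is the predecessor of the number of rounds. *)
apply: (@comp_ext _ (fun v => iteri (a v) (fun i _ => i) 0)).
  by move=> v _; case: (a v).
by apply: comp_iteri => //; cvar.
Qed.
End Arithmetic.

Lemma comp_mul k a b : comp k a -> comp k b -> comp k (fun v => a v * b v).
Proof.
move=> ca cb; apply: (@comp_ext _ (fun v => iteri (a v) (fun _ n => b v + n) 0)).
  by move=> v _; elim: (a v) => //= n ->; rewrite mulSn.
by apply: comp_iteri => //; [apply: comp_add; cvar | cvar].
Qed.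

Lemma comp_sub k a b : comp k a -> comp k b -> comp k (fun v => a v - b v).
Proof.
move=> ca cb; apply: (@comp_ext _ (fun v => iteri (b v) (fun _ n => n.-1) (a v))).
  by move=> v _; elim: (b v) => [|n /= ->]; rewrite ?subn0 ?subnS.
by apply: comp_iteri => //; apply: comp_pred; cvar.
Qed.

Lemma comp_exp2 k a : comp k a -> comp k (fun v => 2 ^ a v).
Proof.
move=> ca; apply: (@comp_ext _ (fun v => iteri (a v) (fun _ n => n + n) 1)).
  by move=> v _; elim: (a v) => //= n ->; rewrite expnS mul2n addnn.
by apply: comp_iteri => //; [apply: comp_add; cvar | cvar].
Qed.

Lemma comp_neg k (p : seq nat -> bool) : comp k p -> comp k (fun v => ~~ p v).
Proof.
move=> cp; apply: (@comp_ext _ (fun v => 1 - p v)); first by move=> v _; case: (p v).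
by apply: comp_sub => //; exact: comp_const.
Qed.

Lemma comp_and k (p q : seq nat -> bool) :
  comp k p -> comp k q -> comp k (fun v => p v && q v).
Proof.
move=> cp cq; apply: (@comp_ext _ (fun v => p v * q v)); last exact: comp_mul.
by move=> v _; rewrite mulnb.
Qed.

Lemma comp_or k (p q : seq nat -> bool) :
  comp k p -> comp k q -> comp k (fun v => p v || q v).
Proof.
move=> cp cq; apply: (@comp_ext _ (fun v => ~~ (~~ p v && ~~ q v))).
  by move=> v _; rewrite -negb_or negbK.
by do ?[apply: comp_neg | apply: comp_and].
Qed.

Lemma comp_imply k (p q : seq nat -> bool) :
  comp k p -> comp k q -> comp k (fun v => p v ==> q v).
Proof.
move=> cp cq; apply: (@comp_ext _ (fun v => ~~ p v || q v)).
  by move=> v _; rewrite implybE.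
by apply: comp_or => //; apply: comp_neg.
Qed.

Lemma comp_if k (p : seq nat -> bool) a b :
  comp k p -> comp k a -> comp k b -> comp k (fun v => if p v then a v else b v).
Proof.
move=> cp ca cb; apply: (@comp_ext _ (fun v => p v * a v + ~~ p v * b v)).
  by move=> v _; case: (p v); rewrite ?mul1n ?mul0n ?addn0.
by apply: comp_add; apply: comp_mul => //; apply: comp_neg.
Qed.

Lemma comp_eq k a b : comp k a -> comp k b -> comp k (fun v => a v == b v).
Proof.
move=> ca cb; apply: (@comp_ext _ (fun v => 1 - ((a v - b v) + (b v - a v)))).
  move=> v _; rewrite eqn_leq -!subn_eq0.
  by case: (a v - b v) => [|?]; case: (b v - a v).
by apply: comp_sub; [cvar | apply: comp_add; apply: comp_sub].
Qed.

Lemma comp_sum k n (g : seq nat -> nat -> nat) :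
  comp k n -> comp k.+1 (fun v => g (behead v) (head 0 v)) ->
  comp k (fun v => \sum_(i < n v) g v i).
Proof.
move=> cn cg; apply: (@comp_ext _ (fun v => iteri (n v) (fun i s => s + g v i) 0)).
  move=> v _; elim: (n v) => [|m /= ->]; first by rewrite big_ord0.
  by rewrite big_ord_recr.
apply: comp_iteri => //; last by cvar.
apply: comp_add; first by cvar.
by apply: comp_ext (comp_skip (ltn0Sn _) cg) => -[|x [|y v]] //= _; rewrite drop0.
Qed.

(** * Coding, decoding and folding of lists *)

#[local] Notation code := CodeSeq.code.
#[local] Notation decode := CodeSeq.decode.

Lemma comp_code_cons k a b :
  comp k a -> comp k b -> comp k (fun v => code (a v :: decode (b v))).
Proof.
(* This is the value of [CodeSeq.code] on a cons: the power of two holds the head, the odd factor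
   the tail. *)
move=> ca cb; apply: (@comp_ext _ (fun v => 2 ^ a v * (b v + b v).+1)).
  by move=> v _; rewrite /= CodeSeq.decodeK addnn.
apply: comp_mul.  exact: comp_exp2. apply: comp_succ.  exact: comp_add.
Qed.

(* Both components of [c = code (x :: s)] are found by exhausting the pairs
   below [c]. *)
Lemma sum_code_cons (F : nat -> nat -> nat) c :
  \sum_(i < c) \sum_(j < c) F i j * (code ((i : nat) :: decode j) == c) =
  if decode c is x :: s then F x (code s) else 0.
Proof.
have := esym (CodeSeq.decodeK c); case: (decode c) => [|x s] ->.
  by rewrite /= big_ord0.
set n := code (x :: s).
have lt_x : x < n by have := CodeSeq.ltn_code (x :: s) => /= /andP[].
have lt_s : code s < n.
  rewrite /n /= -[(code s).+1]mul1n leq_mul ?expn_gt0 // ltnS -addnn.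
  exact: leq_addr.
have E i j : (code ((i : nat) :: decode j) == n) = (i == x) && (j == code s).
  rewrite (can_eq CodeSeq.codeK) eqseq_cons; congr (_ && _).
  by rewrite -(can_eq CodeSeq.codeK) CodeSeq.decodeK.
rewrite (bigD1 (Ordinal lt_x)) //= (bigD1 (Ordinal lt_s)) //= E !eqxx muln1.
rewrite big1 ?addn0 => [|j jNs].
  2: by rewrite E (negPf (jNs : (j != code s :> nat))) andbF muln0.
rewrite big1 ?addn0 // => i iNx; rewrite big1 // => j _.
by rewrite E (negPf (iNx : (i != x :> nat))) muln0.
Qed.

(** Bounded sums replace an inversion of the code. Taking for [F] one of the two projections yields
    the head or the code of the tail. *)
Lemma comp_sum_code_cons k a (F : nat -> nat -> nat) :
  comp k.+2 (fun v => F (head 0 (behead v)) (head 0 v)) -> comp k a ->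
  comp k (fun v => if decode (a v) is x :: s then F x (code s) else 0).
Proof.
move=> cF ca; apply: (@comp_ext _ (fun v => \sum_(i < a v) \sum_(j < a v)
    F i j * (code ((i : nat) :: decode j) == a v))).
  by move=> v _; rewrite sum_code_cons.
pose h v i j := F i j * (code (i :: decode j) == a v).
apply: (comp_sum (g := fun v i => \sum_(j < a v) h v i j)) => //.
apply: (comp_sum (g := fun v j => h (behead v) (head 0 v) j)); first by cvar.
apply: comp_mul => //; apply: comp_eq; last by cvar.
by apply: comp_code_cons; cvar.
Qed.

Lemma comp_head_decode k a : comp k a -> comp k (fun v => head 0 (decode (a v))).
Proof. exact: (@comp_sum_code_cons _ _ (fun x _ => x)) (comp_weak (comp_head k)). Qed.

Lemma comp_behead_decode k a :
  comp k a -> comp k (fun v => code (behead (decode (a v)))).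
Proof.
move=> ca; apply: comp_ext (comp_sum_code_cons (F := fun _ m => m) (comp_head k.+1) ca).
by move=> v _; case: (decode (a v)).
Qed.

Lemma comp_drop_decode k a n :
  comp k a -> comp k n -> comp k (fun v => code (drop (n v) (decode (a v)))).
Proof.
move=> ca cn; apply: (@comp_ext _ (fun v =>
    iteri (n v) (fun _ c => code (behead (decode c))) (a v))).
  move=> v _; elim: (n v) => [|m /= ->]; first by rewrite drop0 CodeSeq.decodeK.
  by rewrite CodeSeq.codeK -drop1 drop_drop add1n.
by apply: comp_iteri => //; apply: comp_behead_decode; cvar.
Qed.

Lemma comp_nth_decode k a n :
  comp k a -> comp k n -> comp k (fun v => nth 0 (decode (a v)) (n v)).
Proof.
move=> ca cn; apply: comp_ext (comp_head_decode (comp_drop_decode ca cn)).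
by move=> v _; rewrite CodeSeq.codeK -nth0 nth_drop addn0.
Qed.

(** Allows a code to serve as the number of rounds of a loop over the list that it codes. *)
Lemma size_code s : size s <= code s.
Proof.
elim: s => //= x s IHs; rewrite -[(size s).+1]mul1n leq_mul ?expn_gt0 //.
by rewrite ltnS (leq_trans IHs) // -addnn leq_addr.
Qed.

(** A right fold consumes the list from its end, so round [i] treats the suffix starting at
    [l v - i.+1], with truncated positions counted down from the code [l v]. The code bounds the
    length; the early rounds meet an empty suffix, whose code is 0, and leave the accumulator
    unchanged. *)
Lemma comp_foldr k l z (g : seq nat -> nat -> nat -> nat) :
  comp k l ->
  comp k.+2 (fun v => g (behead (behead v)) (head 0 v) (head 0 (behead v))) ->
  comp k z -> comp k (fun v => foldr (g v) (z v) (decode (l v))).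
Proof.
move=> cl cg cz.
pose d v i := code (drop (l v - i.+1) (decode (l v))).
apply: (@comp_ext _ (fun v => iteri (l v)
    (fun i r => if d v i == 0 then r else g v (head 0 (decode (d v i))) r) (z v))).
  move=> v _; set h := fun i r => _; set s := decode (l v).
  have sz : size s <= l v by rewrite -[l v]CodeSeq.decodeK; exact: size_code.
  suffices H i : i <= l v ->
      iteri i h (z v) = foldr (g v) (z v) (drop (l v - i) s).
    by rewrite H // subnn drop0.
  elim: i => [_|i IHi lt_i]; first by rewrite subn0 drop_oversize.
  rewrite /= {}IHi 1?ltnW // /h /d CodeSeq.codeK -/s.
  rewrite -(subnSK lt_i); case: (ltnP (l v - i.+1) (size s)) => le_s.
    rewrite (drop_nth 0 le_s) ifN //=.
    by rewrite muln_eq0 expn_eq0.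
  by rewrite !drop_oversize // (leq_trans le_s).
have cd : comp k.+2 (fun v => d (behead (behead v)) (head 0 v)).
  by apply: comp_drop_decode; [cvar | apply: comp_sub; [cvar | apply: comp_succ; cvar]].
apply: comp_iteri => //; apply: comp_if; [|by cvar|].
  by apply: comp_eq => //; exact: comp_const.
(* The head of the suffix becomes a fresh variable; the loop counter, now just below it, is what
   [comp_skip] removes. *)
apply: (comp_let (F := fun w => g (behead (behead (behead w))) (head 0 w)
                                  (head 0 (behead (behead w))))).
  by apply: comp_ext (comp_skip (ltn0Sn _) cg) => -[|x [|y v]] //= _; rewrite drop0.
exact: comp_head_decode.
Qed.

Lemma comp_has k l (p : seq nat -> nat -> bool) :
  comp k l -> comp k.+1 (fun v => p (behead v) (head 0 v)) ->
  comp k (fun v => has (p v) (decode (l v))).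
Proof.
move=> cl cp; apply: (@comp_ext _ (fun v =>
    foldr (fun x r => if p v x then 1 else r) 0 (decode (l v)))).
  by move=> v _; elim: (decode (l v)) => //= x s ->; case: (p v x).
apply: comp_foldr => //; last by cvar.
apply: comp_if; [|by cvar..].
by apply: comp_ext (comp_skip (ltn0Sn _) cp) => -[|x [|y v]] //= _; rewrite drop0.
Qed.

Lemma comp_all k l (p : seq nat -> nat -> bool) :
  comp k l -> comp k.+1 (fun v => p (behead v) (head 0 v)) ->
  comp k (fun v => all (p v) (decode (l v))).
Proof.
move=> cl cp; apply: (@comp_ext _ (fun v => ~~ has (fun x => ~~ p v x) (decode (l v)))).
  by move=> v _; rewrite has_predC negbK.
by apply: comp_neg; apply: comp_has => //; apply: comp_neg.
Qed.

Lemma comp_code_filter k l (p : seq nat -> nat -> bool) :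
  comp k l -> comp k.+1 (fun v => p (behead v) (head 0 v)) ->
  comp k (fun v => code (filter (p v) (decode (l v)))).
Proof.
move=> cl cp; apply: (@comp_ext _ (fun v =>
    foldr (fun x r => if p v x then code (x :: decode r) else r) 0 (decode (l v)))).
  move=> v _; elim: (decode (l v)) => //= x s ->.
  by case: (p v x) => //=; rewrite CodeSeq.decodeK.
apply: comp_foldr => //; last by cvar.
apply: comp_if; [|by apply: comp_code_cons; cvar|by cvar].
by apply: comp_ext (comp_skip (ltn0Sn _) cp) => -[|x [|y v]] //= _; rewrite drop0.
Qed.

(** * Words *)

Section Words.
Variable T : Type.
Implicit Types (u v w : word T) (s : seq T).

Definition wcons (a : T) w : word T :=
  match w with
  | Fin s => Fin (a :: s)
  | Inf u => Inf (fun n => if n is m.+1 then u m else a)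
  end.

Definition wcat s w : word T := foldr wcons w s.

Lemma wat_wcons a w n :
  wat (wcons a w) n = if n is m.+1 then wat w m else Some a.
Proof. by case: w => [s|u]; case: n. Qed.

Lemma wat_inj u v : (forall n, wat u n = wat v n) -> u = v.
Proof. by move=> uv; apply: wprefix_anti => n a; rewrite uv. Qed.

Lemma word_case w : w = Fin [::] \/ exists a w', w = wcons a w'.
Proof.
case: w => [[|a s]|u]; [by left | by right; exists a, (Fin s) | right].
by exists (u 0), (Inf (fun n => u n.+1)); apply: wat_inj => -[].
Qed.

Lemma wprefix_wcons a b u v :
  wprefix (wcons a u) (wcons b v) <-> a = b /\ wprefix u v.
Proof.
split=> [ab|[-> uv] n c]; last by rewrite !wat_wcons; case: n => // n; exact: uv.
split; first by have := ab 0 a; rewrite !wat_wcons => /(_ erefl)[].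
by move=> n c; have := ab n.+1 c; rewrite !wat_wcons.
Qed.

Lemma wprefix_nil w : wprefix (Fin [::]) w.
Proof. by move=> [|n] a. Qed.

Lemma wprefix_wcons_nil a w : ~ wprefix (wcons a w) (Fin [::]).
Proof. by move=> /(_ 0 a); rewrite wat_wcons => /(_ erefl). Qed.

Lemma wprefix_wconsl a u v :
  wprefix (wcons a u) v -> exists2 v', v = wcons a v' & wprefix u v'.
Proof.
case: (word_case v) => [->|[b [v' ->]]]; first by move/wprefix_wcons_nil.
by move=> /wprefix_wcons[-> uv']; exists v'.
Qed.

Lemma wcons_nil a w : wcons a w <> Fin [::].
Proof. by case: w. Qed.

Lemma wcons_inj a b u v : wcons a u = wcons b v -> a = b /\ u = v.
Proof.
move=> E; have H n : wat (wcons a u) n = wat (wcons b v) n by rewrite E.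
split; first by have := H 0; rewrite !wat_wcons => -[].
by apply: wat_inj => n; have := H n.+1; rewrite !wat_wcons.
Qed.

Lemma wcat_cat s1 s2 w : wcat (s1 ++ s2) w = wcat s1 (wcat s2 w).
Proof. by rewrite /wcat foldr_cat. Qed.

Lemma wcat_Fin s t : wcat s (Fin t) = Fin (s ++ t).
Proof. by elim: s => //= a s ->. Qed.

(** An infinite word is a prefix of itself only, so the smaller word must be finite; induction on it
    then exhibits the first extra letter. *)
Lemma wsprefixP u v :
  wsprefix u v <-> exists s a w, u = Fin s /\ v = wcat s (wcons a w).
Proof.
split=> [[]|[s [a [w [-> ->]]]]]; last first.
  split; first elim: s => [|b s IHs] /=; first exact: wprefix_nil.
    have [_] := wprefix_wcons b b (Fin s) (wcat s (wcons a w)).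
    by apply.
  by elim: s => [|b s IHs] /=; [move/esym/wcons_nil | case/(@wcons_inj b b (Fin s))].
case: u => [s|u] uv uNv; last first.
  by case: uNv; apply: wat_inj => n; rewrite (uv n (u n)).
elim: s v uv uNv => [|b s IHs] v.
  by case: (word_case v) => [->//|[a [w ->]] _ _]; exists [::], a, w.
case/(@wprefix_wconsl b (Fin s)) => v' -> sv' H.
have [|t [a [w [[->] ->]]]] := IHs v' sv'.
  by move=> E; apply: H; rewrite -E.
by exists (b :: t), a, w.
Qed.

(** Images of infinite words are chosen by [cid]; uniqueness lets them be computed by exhibiting any
    least upper bound. *)
Lemma wlub_uniq (c : nat -> seq T) u v : is_wlub c u -> is_wlub c v -> u = v.
Proof. by move=> [u1 u2] [v1 v2]; apply: wprefix_anti; [exact: u2 | exact: v2]. Qed.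

End Words.

(** * Images of finite and infinite words under letter-erasing homomorphisms *)

Section Homomorphisms.
Variables (A B : Type) (f : A -> option B).
Implicit Types (w : word A) (s : seq A).

Definition silent_word w := forall n a, wat w n = Some a -> f a = None.

Lemma whom_wlub u : is_wlub (fun n => pmap f (mkseq u n)) (whom f (Inf u)).
Proof. exact: svalP. Qed.

Lemma whom_wcons a w :
  whom f (wcons a w) = if f a is Some b then wcons b (whom f w) else whom f w.
Proof.
case: w => [s|u]; first by rewrite /=; case: (f a).
set u' := fun n => if n is m.+1 then u m else a.
have [ub lub] := whom_wlub u; apply: wlub_uniq (whom_wlub u') _.
(* The chain of [u'] is that of [u] shifted by one, with the image of [a] in front; hence the case
   [n = 0] is treated apart below. *)
have E n : pmap f (mkseq u' n.+1) =
    if f a is Some b then b :: pmap f (mkseq u n) else pmap f (mkseq u n).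
  by rewrite /mkseq /= (iotaDl 1) -map_comp; case: (f a).
move: (E); case: (f a) => [b|] {}E; split=> [[|n]|v vP]; try exact: wprefix_nil.
- have [_] := wprefix_wcons b b (Fin (pmap f (mkseq u n))) (whom f (Inf u)).
  by rewrite E; apply.
(* The term of index 1 is the single letter [b], so every upper bound starts with [b] and its tail
   bounds the chain of [u]. *)
- have := vP 1; rewrite E => /(@wprefix_wconsl _ b (Fin _))[v' vE _].
  move: vP; rewrite vE => vP; apply/wprefix_wcons; split=> //; apply: lub => n.
  by have := vP n.+1; rewrite E => /(@wprefix_wcons _ b b (Fin _))[].
- by rewrite E.
- by apply: lub => n; have := vP n.+1; rewrite E.
Qed.

Lemma whom_wcat s w : whom f (wcat s w) = wcat (pmap f s) (whom f w).
Proof.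
by elim: s => //= a s IHs; rewrite whom_wcons; case: (f a) => [b|]; rewrite /= IHs.
Qed.

Lemma whom_silent w : silent_word w -> whom f w = Fin [::].
Proof.
case: w => [s|u] fN.
  elim: s fN => [//|a s IHs] fN; rewrite (whom_wcons a (Fin s)) (fN 0 a erefl).
  by apply: IHs => n b; exact: (fN n.+1).
apply: wlub_uniq (whom_wlub u) _; have E n : pmap f (mkseq u n) = [::].
  by elim: n => // n IHn; rewrite mkseqS -cats1 pmap_cat IHn /= (fN n (u n) erefl).
by split=> [n|v _]; rewrite ?E; exact: wprefix_nil.
Qed.

(** Excluded middle decides whether a visible letter occurs at all, which matters for infinite
    words; induction on the position of any such letter then finds the first. *)
Lemma first_visible w :
  silent_word w \/
  exists s a w' b, [/\ w = wcat s (wcons a w'), pmap f s = [::] & f a = Some b].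
Proof.
have [[n [a [b [wn fa]]]]|H] :=
    pselect (exists n a b, wat w n = Some a /\ f a = Some b); last first.
  by left=> n a wn; case E: (f a) => [b|//]; case: H; exists n, a, b.
right; elim: n w wn => [|n IHn] w; case: (word_case w) => [->//|[c [w' ->]]].
  by rewrite wat_wcons => -[ca]; exists [::], a, w', b; rewrite ca.
rewrite wat_wcons => wn; case fc: (f c) => [d|]; first by exists [::], c, w', d.
have [s [a' [w'' [b' [-> sN fa']]]]] := IHn w' wn.
by exists (c :: s), a', w'', b'; rewrite /= fc.
Qed.

(** Factorisations of the image lift to the word: each letter of [t] comes from the next visible
    letter of [w], taken off together with the silent letters before it. *)
Lemma whom_split w (y : word B) (t : seq B) :
  whom f w = wcat t y ->
  exists v w', [/\ w = wcat v w', pmap f v = t & whom f w' = y].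
Proof.
elim: t w => [|b t IHt] w /= E; first by exists [::], w.
have [sw|[v [a [w1 [b' [wE vN fa]]]]]] := first_visible w.
  have := whom_silent sw; rewrite E => bN; case: (wcons_nil bN).
move: E; rewrite wE whom_wcat vN /= whom_wcons fa => E.
have [bE] := wcons_inj E; move=> /IHt[v' [w' [-> <- <-]]]; exists (v ++ a :: v'), w'.
by rewrite wcat_cat pmap_cat vN /= fa bE.
Qed.

End Homomorphisms.

(** * Runs *)

Section Runs.
Variables (Lab : eqType) (A : fsa Lab).
Implicit Types (q : fsa_state A) (s : seq Lab) (w : word Lab).

(** The initial state gives [lang A] by conversion; a variable starting state permits induction
    along words. *)
Definition lang_from q w : Prop := exists r : nat -> fsa_state A,
  r 0 = q /\ forall n a, wat w n = Some a -> (r n, a, r n.+1) \in fsa_trans A.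

Fixpoint run q s q' : Prop :=
  if s is a :: s' then exists2 q1, (q, a, q1) \in fsa_trans A & run q1 s' q'
  else q = q'.

Definition live q : bool := has (fun t => t.1.1 == q) (fsa_trans A).

Lemma liveP q : reflect (exists a q', (q, a, q') \in fsa_trans A) (live q).
Proof.
apply: (iffP hasP) => [[[[p a] q'] tA /= /eqP <-]|[a [q' tA]]].
  by exists a, q'.
by exists (q, a, q') => /=.
Qed.

Lemma run_cat q s1 s2 q' :
  run q (s1 ++ s2) q' <-> exists2 q1, run q s1 q1 & run q1 s2 q'.
Proof.
elim: s1 q => [|a s1 IHs] q /=; first by split=> [|[? ->]] //; exists q.
split=> [[p qp /IHs[q1 pq1 q1q']]|[q1 [p qp pq1] q1q']].
  by exists q1 => //; exists p.
by exists p => //; apply/IHs; exists q1.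
Qed.

Lemma run_rcons q s a q' :
  run q (rcons s a) q' <-> exists2 q1, run q s q1 & (q1, a, q') \in fsa_trans A.
Proof.
rewrite -cats1 run_cat /=; split=> [[q1 H [p ? <-]]|[q1 H ?]]; exists q1 => //.
by exists q'.
Qed.

Lemma lang_from_nil q : lang_from q (Fin [::]).
Proof. by exists (fun=> q); split=> // -[]. Qed.

Lemma lang_from_wcons q a w :
  lang_from q (wcons a w) <->
  exists2 q', (q, a, q') \in fsa_trans A & lang_from q' w.
Proof.
split=> [[r [<- rP]]|[q' qq' [r [r0 rP]]]].
  exists (r 1); first by apply: rP; rewrite wat_wcons.
  by exists (fun n => r n.+1); split=> // n b wn; apply: rP; rewrite wat_wcons.
exists (fun n => if n is m.+1 then r m else q); split=> // n b.
by rewrite wat_wcons; case: n => [[<-]|n wn]; [rewrite r0 | exact: rP].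
Qed.

Lemma lang_from_wcat q s w :
  lang_from q (wcat s w) <-> exists2 q', run q s q' & lang_from q' w.
Proof.
elim: s q => [|a s IHs] q /=; first by split=> [|[? ->]] //; exists q.
rewrite lang_from_wcons; split=> [[p qp /IHs[q' pq' ?]]|[q' [p qp pq'] ?]].
  by exists q' => //; exists p.
by exists p => //; apply/IHs; exists q'.
Qed.

(** A form of maximality read off from states; an infinite word has no end to constrain. *)
Definition full q w : Prop :=
  lang_from q w /\ forall s, w = Fin s -> exists2 q', run q s q' & ~~ live q'.

Lemma full_nil q : full q (Fin [::]) <-> ~~ live q.
Proof.
split=> [[_ /(_ [::] erefl)[q' <-]]|H] //.
by split=> [|s [<-]]; [exact: lang_from_nil | exists q].
Qed.

(* A finite word ends in some state without outgoing transition as soon as it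
   is maximal; the converse needs determinism. *)
Lemma maximal_full q w : lang_from q w -> maximal (lang_from q) w -> full q w.
Proof.
move=> Lw maxw; split=> // s wE; move: Lw maxw; rewrite wE -[s]cats0 -wcat_Fin.
move=> /lang_from_wcat[q' qq' _] maxs; exists q'; first by rewrite cats0.
apply/negP => /liveP[a [q'' tA]].
have Lz : lang_from q (wcat s (Fin [:: a])).
  apply/lang_from_wcat; exists q' => //.
  apply/(lang_from_wcons q' a (Fin [::])).
  by exists q'' => //; exact: lang_from_nil.
have : wcat s (Fin [:: a]) = wcat s (Fin [::]).
  apply: maxs Lz _; rewrite !wcat_Fin cats0 => n b /= H.
  by rewrite onth_cat (onth_lt H).
rewrite !wcat_Fin => -[/(congr1 size)/eqP].
by rewrite !size_cat eqn_add2l.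
Qed.

Hypothesis detA : deterministic A.

Lemma full_wcons q a w :
  full q (wcons a w) <-> exists2 q', (q, a, q') \in fsa_trans A & full q' w.
Proof.
split=> [[/lang_from_wcons[q' qq' Lw] H]|[q' qq' [Lw H]]].
  exists q' => //; split=> // s wE; have [|q'' /=] := H (a :: s); first by rewrite wE.
  by move=> [p qp pq''] deadq; exists q''; rewrite // (detA qq' qp).
split=> [|s]; first by apply/lang_from_wcons; exists q'.
case: w Lw H => // t Lw H [<-]; have [q'' ? ?] := H t erefl.
by exists q'' => //; exists q'.
Qed.

Lemma full_wcat q s w :
  full q (wcat s w) <-> exists2 q', run q s q' & full q' w.
Proof.
elim: s q => [|a s IHs] q /=; first by split=> [|[? ->]] //; exists q.
rewrite full_wcons; split=> [[p qp /IHs[q' pq' ?]]|[q' [p qp pq'] ?]].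
  by exists q' => //; exists p.
by exists p => //; apply/IHs; exists q'.
Qed.

(** By determinism the run of any extension of a finite [w] follows that of [w] into a dead state,
    where it must stop. An infinite word has no proper extension. *)
Lemma full_maximal q w : full q w -> maximal (lang_from q) w.
Proof.
case: w => [s|u] Fw z Lz wz; last first.
  by apply/esym/wat_inj => n; rewrite (wz n (u n)).
elim: s q z Fw Lz wz => [|a s IHs] q z.
  move=> /full_nil deadq; case: (word_case z) => // -[a [w ->]].
  by case/lang_from_wcons => q' tA _; case/liveP: deadq; exists a, q'.
move=> /(full_wcons q a (Fin s))[q' qq' Fs] Lz.
move=> /(@wprefix_wconsl _ a (Fin s))[z' zE sz'].
move: Lz; rewrite zE => /lang_from_wcons[q'' qq'' Lz'].
by rewrite (IHs q' z') // (detA qq' qq'').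
Qed.

(** Either some finite run with good labels reaches a dead state, or none does; in the latter case
    the invariant [G'] makes every visited state live and is preserved by a good step, so iterating
    a chosen step gives an infinite word. *)
Lemma full_run (G : fsa_state A -> Prop) (good : Lab -> Prop) q :
  (forall p, G p -> live p ->
    exists a p', [/\ (p, a, p') \in fsa_trans A, good a & G p']) ->
  G q -> exists2 w, full q w & forall n a, wat w n = Some a -> good a.
Proof.
move=> step Gq; pose ends p := exists s p',
  [/\ run p s p', ~~ live p' & forall n a, onth s n = Some a -> good a].
have [[s [p [qp deadp gs]]]|Nends] := pselect (ends q).
  exists (Fin s) => //; split=> [|t [<-]]; last by exists p.
  by rewrite -[s]cats0 -wcat_Fin lang_from_wcat; exists p => //; exact: lang_from_nil.
pose G' p := G p /\ ~ ends p.
have step' p : G' p ->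
    exists t : Lab * fsa_state A, [/\ (p, t.1, t.2) \in fsa_trans A, good t.1 & G' t.2].
  move=> [Gp Np]; have lp : live p.
    by apply/negPn/negP => deadp; apply: Np; exists [::], p; split=> //; case.
  have [a [p' [tA ga Gp']]] := step p Gp lp; exists (a, p'); split=> //; split=> //.
  move=> [s [p'' [r dead gs]]]; apply: Np; exists (a :: s), p''.
  split=> //; first by exists p'.
  by move=> [|n] b /=; [case=> <- | exact: gs].
have G'q : G' q by [].
(* The step function must be total: outside [G'] it takes as a default value some step available
   from [q]. *)
have /choice[h hP] p : exists t : Lab * fsa_state A,
    G' p -> [/\ (p, t.1, t.2) \in fsa_trans A, good t.1 & G' t.2].
  have [/step'[t tP]|Np] := pselect (G' p); first by exists t.
  by have [t _] := step' q G'q; exists t.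
pose r n := iter n (fun p => (h p).2) q.
have rG n : G' (r n) by elim: n => // n /hP[].
exists (Inf (fun n => (h (r n)).1)) => [|n a [<-]]; last by case: (hP _ (rG n)).
split=> //; exists r; split=> // n a [<-].
by case: (hP _ (rG n)).
Qed.

End Runs.

(** * A criterion for branch-awareness *)

Section Criterion.
Variables (P M : eqType).
Implicit Types (X : P) (i j : interaction P M).

Definition silent X i : bool := (X != sender i) && (X != receiver i).

Lemma silentP X i : reflect (proj_int X i = None) (silent X i).
Proof.
rewrite /silent /proj_int; case: eqP => _; first by constructor.
by case: eqP => _; constructor.
Qed.

(** An action retains sender, receiver and message. For this reason [sync_step] can compare
    interactions instead of their projections. *)
Lemma proj_int_inj X i j a :
  proj_int X i = Some a -> proj_int X j = Some a -> i = j.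
Proof.
case: i j => [[[s r] m] ij] [[[s' r'] m'] ij'] Hi Hj.
apply: val_inj => /=; move: ij ij' Hi Hj; rewrite /proj_int /sender /receiver /message /=.
do 2![case: eqP => ? | case: eqP => ?] => ij ij'; do ?[case: eqP => ?];
  by move=> // [<-] // [-> -> ->].
Qed.

Variable A : c_automaton P M.
Notation Q := (fsa_state A).
Notation E := (fsa_trans A).
Implicit Types (p x : Q * Q) (q : Q).

Definition enabled X q : bool :=
  has (fun t => (t.1.1 == q) && ~~ silent X t.1.2) E.

(* The least fixed point is the set of states without maximal run on which [X]
   does nothing. *)
Definition exits X (S : {set Q}) : {set Q} :=
  [set q | live q &&
    all (fun t => (t.1.1 == q) && silent X t.1.2 ==> (t.2 \in S)) E].

(** An asynchronous product of the automaton with itself: silent moves are made by one component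
    alone, visible ones jointly. *)
Definition sync_step X p x : bool :=
  [|| has (fun t => [&& t.1.1 == p.1, t.2 == x.1, silent X t.1.2 & x.2 == p.2]) E,
      has (fun t => [&& t.1.1 == p.2, t.2 == x.2, silent X t.1.2 & x.1 == p.1]) E
    | has (fun t => [&& t.1.1 == p.1, t.2 == x.1, ~~ silent X t.1.2 &
        has (fun t' => [&& t'.1.1 == p.2, t'.2 == x.2 & t'.1.2 == t.1.2]) E]) E].

(* The least fixed point is the set of pairs of states reached by two words
   with the same projection on [X]. *)
Definition sync X (S : {set Q * Q}) : {set Q * Q} :=
  [set x | (x == (fsa_init A, fsa_init A)) || [exists p in S, sync_step X p x]].

(** Testing a single transition of [p.2] suffices: silent moves preceding the next visible one lead
    to another pair of the fixed point. *)
Definition aware X : bool :=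
  [forall p in fixset (sync X), enabled X p.2 ==> (p.1 \in fixset (exits X))].

Lemma exits_mono X : {homo exits X : S1 S2 / S1 \subset S2}.
Proof.
move=> S1 S2 /subsetP S12; apply/subsetP => q; rewrite !inE => /andP[-> /=].
by apply: sub_all => t /implyP H; apply/implyP => /H /S12.
Qed.

Lemma sync_mono X : {homo sync X : S1 S2 / S1 \subset S2}.
Proof.
move=> S1 S2 /subsetP S12; apply/subsetP => x; rewrite !inE => /orP[->//|].
move=> /existsP[p /andP[/S12 pS step]]; apply/orP; right; apply/existsP.
by exists p; rewrite pS.
Qed.

Lemma enabledP X q :
  reflect (exists i q', (q, i, q') \in E /\ ~~ silent X i) (enabled X q).
Proof.
apply: (iffP hasP) => [[[[p i] q'] tE /= /andP[/eqP<- vi]]|[i [q' [tE vi]]]].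
  by exists i, q'.
by exists (q, i, q') => //=; rewrite eqxx.
Qed.

Variant sync_step_spec X p x : Prop :=
| SyncLeft i of (p.1, i, x.1) \in E & silent X i & x.2 = p.2
| SyncRight i of (p.2, i, x.2) \in E & silent X i & x.1 = p.1
| SyncBoth i of (p.1, i, x.1) \in E & (p.2, i, x.2) \in E & ~~ silent X i.

Lemma sync_stepP X p x : sync_step X p x <-> sync_step_spec X p x.
Proof.
split=> [/or3P[]/hasP[[[q i] q'] tE /=]|].
- by move=> /and4P[/eqP ? /eqP ? si /eqP ?]; subst q q'; exact: SyncLeft tE si _.
- by move=> /and4P[/eqP ? /eqP ? si /eqP ?]; subst q q'; exact: SyncRight tE si _.
- move=> /and4P[/eqP ? /eqP ? vi /hasP[[[r j] r'] t'E /=]]; subst q q'.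
  by move=> /and3P[/eqP ? /eqP ? /eqP ?]; subst r r' j; exact: SyncBoth tE t'E vi.
case=> i t1 => [si xp|si xp|t2 vi]; apply/or3P; [apply: Or31|apply: Or32|apply: Or33].
- by apply/hasP; exists (p.1, i, x.1); rewrite //= si xp !eqxx.
- by apply/hasP; exists (p.2, i, x.2); rewrite //= si xp !eqxx.
- apply/hasP; exists (p.1, i, x.1); rewrite //= vi !eqxx /=.
  by apply/hasP; exists (p.2, i, x.2); rewrite //= !eqxx.
Qed.

Lemma sync_init X : (fsa_init A, fsa_init A) \in fixset (sync X).
Proof. by rewrite -(fixsetK (@sync_mono X)) inE eqxx. Qed.

Lemma sync_next X p x :
  p \in fixset (sync X) -> sync_step_spec X p x -> x \in fixset (sync X).
Proof.
move=> pS /sync_stepP st; rewrite -(fixsetK (@sync_mono X)) inE.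
by apply/orP; right; apply/existsP; exists p; rewrite pS.
Qed.

(** From left to right, induction on the iterates defining [fixset] appends one letter per step.
    Conversely a last letter that is silent is removed from its own word; when both last letters are
    visible, equal projections make them the same interaction and they are removed together. *)
Lemma syncP X q1 q2 :
  (q1, q2) \in fixset (sync X) <->
  exists s1 s2, [/\ run (fsa_init A) s1 q1, run (fsa_init A) s2 q2
                  & pmap (proj_int X) s1 = pmap (proj_int X) s2].
Proof.
split.
  rewrite /fixset; elim: #|_| q1 q2 => [|n IHn] q1 q2; rewrite inE //.
  case/orP => [/eqP[-> ->]|/existsP[[p1 p2] /andP[/IHn[s1 [s2 [r1 r2 s12]]]]]].
    by exists [::], [::].
  case/sync_stepP => /= i t1.
  - move=> /silentP si ->; exists (rcons s1 i), s2; split=> //.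
      by apply/run_rcons; exists p1.
    by rewrite -cats1 pmap_cat /= si cats0.
  - move=> /silentP si ->; exists s1, (rcons s2 i); split=> //.
      by apply/run_rcons; exists p2.
    by rewrite -cats1 pmap_cat /= si cats0.
  - move=> t2 vi; exists (rcons s1 i), (rcons s2 i); split.
    + by apply/run_rcons; exists p1.
    + by apply/run_rcons; exists p2.
    + by rewrite -!cats1 !pmap_cat s12.
move=> [s1 [s2 []]].
elim/last_ind: s1 q1 q2 s2 => [|s1 i IH1] q1 q2 s2.
  elim/last_ind: s2 q2 => [|s2 j IH2] q2; first by move=> /= <- <- _; exact: sync_init.
  move=> r1 /run_rcons[p2 r2 t2]; rewrite -cats1 pmap_cat /=.
  case fj: (proj_int X j) => [b|] /=; first by case: (pmap _ s2).
  rewrite cats0 => s12; apply: (sync_next (IH2 p2 r1 r2 s12)).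
  by apply: (@SyncRight _ (q1, p2) (q1, q2) j t2) => //; exact/silentP.
move=> /run_rcons[p1 r1 t1]; rewrite -cats1 pmap_cat /=.
case fi: (proj_int X i) => [b|] /=; last first.
  rewrite cats0 => r2 s12; apply: (sync_next (IH1 p1 q2 s2 r1 r2 s12)).
  by apply: (@SyncLeft _ (p1, q2) (q1, q2) i t1) => //; exact/silentP.
elim/last_ind: s2 q2 => [|s2 j IH2] q2; first by case: (pmap _ s1).
move=> /run_rcons[p2 r2 t2]; rewrite -(cats1 s2) pmap_cat /=.
case fj: (proj_int X j) => [c|] /=; last first.
  rewrite cats0 => s12; apply: (sync_next (IH2 p2 r2 s12)).
  by apply: (@SyncRight _ (q1, p2) (q1, q2) j t2) => //; exact/silentP.
rewrite !cats1 => /rcons_inj[s12 bc]; rewrite -bc in fj.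
rewrite -(proj_int_inj fi fj) in t2.
apply: (sync_next (IH1 p1 p2 s2 r1 r2 s12)).
apply: (@SyncBoth _ (p1, p2) (q1, q2) i t1 t2).
by apply/negP => /silentP; rewrite fi.
Qed.

(** A live state outside the fixed point has a silent transition staying outside, which is the step
    asked for by [full_run]. Conversely a silent maximal word keeps [q] out of every iterate: either
    [q] is dead, or the first letter leads to a state missing from the previous iterate. *)
Lemma exitsP X q :
  q \notin fixset (exits X) <->
  exists2 w, full q w & silent_word (proj_int X) w.
Proof.
split=> [qN|[w]].
  have [|w Fw sw] := @full_run _ A (fun p : Q => p \notin fixset (exits X))
    (silent X) q _ qN.
    move=> p; rewrite -{1}(fixsetK (@exits_mono X)) inE => /nandP[/negP//|].
    move=> /allPn[[[p' i] p''] tE /=]; rewrite negb_imply.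
    move=> /andP[/andP[/eqP<- si] pN] _.
    by exists i, p''.
  by exists w => // n i /sw /silentP.
rewrite /fixset; elim: #|_| q w => [|n IHn] q w Fw sw; first by rewrite inE.
rewrite /= inE; apply/negP => /andP[lq /allP H].
case: (word_case w) => [wE|[i [w' wE]]]; rewrite wE in Fw sw.
  by move/full_nil: Fw; rewrite lq.
case/(full_wcons (@c_det _ _ A)): Fw => q' tE Fw'.
have si : silent X i by apply/silentP/(sw 0); rewrite wat_wcons.
have := H _ tE; rewrite /= eqxx si /=; apply/negP; apply: (IHn q' w' Fw').
by move=> m j wj; apply: (sw m.+1); rewrite wat_wcons.
Qed.

(** Used to complete a word to a maximal one after its distinguishing visible letter. *)
Lemma live_full q : exists w, full q w.
Proof.
have [|w] := @full_run _ A (fun=> True) (fun=> True) q _ I; last by exists w.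
by move=> p _ /liveP[i [p' tE]]; exists i, p'.
Qed.

Lemma branch_awareP : branch_aware (lang A) <-> forall X, aware X.
Proof.
have detA := @c_det _ _ A.
split=> [BA X|H X _ w1 w2 L1 max1 L2 max2 w12].
  apply/forallP => -[q1 q2]; apply/implyP => /syncP[s1 [s2 [r1 r2 s12]]] /=.
  apply/implyP => /enabledP[i [q' [tE vi]]]; apply/negPn/negP.
  case/exitsP => u Fu su; have [v Fv] := live_full q'.
  case fi: (proj_int X i) => [a|]; last by case/silentP: vi.
  have F1 : full (fsa_init A) (wcat s1 u) by apply/full_wcat => //; exists q1.
  have F2 : full (fsa_init A) (wcat s2 (wcons i v)).
    by apply/full_wcat => //; exists q2 => //; apply/full_wcons => //; exists q'.
  have E1 : proj X (wcat s1 u) = Fin (pmap (proj_int X) s1).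
    by rewrite /proj whom_wcat whom_silent // wcat_Fin cats0.
  have E2 : proj X (wcat s2 (wcons i v)) =
            wcat (pmap (proj_int X) s1) (wcons a (proj X v)).
    by rewrite /proj whom_wcat whom_wcons fi s12.
  have pre : wsprefix (proj X (wcat s1 u)) (proj X (wcat s2 (wcons i v))).
    by rewrite E1 E2; apply/wsprefixP; exists (pmap (proj_int X) s1), a, (proj X v).
  (* [branch_aware] speaks of participants only; the visible interaction [i], at position [size s2]
     of a word of the language, makes [X] one. *)
  have part : participant_of (lang A) X.
    exists (wcat s2 (wcons i v)), (size s2), i; split; first by case: F2.
      by elim: (s2) => [|b s IHs]; rewrite /= wat_wcons.
    by move: vi; rewrite /silent negb_and !negbK => /orP[]/eqP; [left|right].
  have [] := BA X part _ _ (proj1 F1) (full_maximal detA F1)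
                (proj1 F2) (full_maximal detA F2); first by case: pre.
  by move=> _ /(_ pre).
(* A strict prefix would split [u] and [v] after equal projections, with a silent rest of [u] and a
   further visible letter in [v]: a reachable pair that [aware] forbids. *)
have nopre u v : full (fsa_init A) u -> full (fsa_init A) v ->
    ~ wsprefix (proj X u) (proj X v).
  move=> Fu Fv /wsprefixP[t [a [y [uE vE]]]].
  have uE' : whom (proj_int X) u = wcat t (Fin [::]).
    by rewrite wcat_Fin cats0.
  have [s1 [u' [u'E s1t u'N]]] := whom_split uE'.
  have [s2 [v' [v'E s2t v'a]]] := whom_split vE.
  have [sv|[s3 [i [v'' [b [v''E s3N fi]]]]]] := first_visible (proj_int X) v'.
    have := whom_silent sv; rewrite v'a => yN; case: (wcons_nil yN).
  move: Fu Fv; rewrite u'E v'E v''E -wcat_cat.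
  case/(full_wcat detA) => q1 r1 Fu'; case/(full_wcat detA) => q2 r2.
  case/(full_wcons detA) => q' tE _.
  have /forallP/(_ (q1, q2))/implyP := H X.
  (* The silent part [s3] before the visible letter is counted in the second word, so that [q2]
     enables [i] at once. *)
  have sy : (q1, q2) \in fixset (sync X).
    by apply/syncP; exists s1, (s2 ++ s3); rewrite pmap_cat s3N cats0 s1t s2t.
  move=> /(_ sy)/implyP/=; have en : enabled X q2.
    by apply/enabledP; exists i, q'; split=> //; apply/silentP; rewrite fi.
  move=> /(_ en); apply/negP/exitsP; exists u' => //.
  have [//|[s4 [j [u'' [c [u''E s4N fj]]]]]] := first_visible (proj_int X) u'.
  have := u'N; rewrite u''E whom_wcat s4N /= whom_wcons fj => yN.
  by case: (wcons_nil yN).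
have F1 := maximal_full L1 max1; have F2 := maximal_full L2 max2.
by split=> //; exact: nopre.
Qed.

End Criterion.

(** * The algorithm *)

#[local] Arguments CodeSeq.code : simpl never.

(* Below, a prefix [c] marks the version on codes of a notion on automata; [E],
   [S] and [U] are codes of lists. *)

Definition fld (c i : nat) : nat := nth 0 (decode c) i.

Definition csilent X t : bool := (X != fld (fld t 1) 0) && (X != fld (fld t 1) 1).

Definition clive E q : bool := has (fun t => fld t 0 == q) (decode E).

Definition cenabled E X q : bool :=
  has (fun t => (fld t 0 == q) && ~~ csilent X t) (decode E).

(** Written with [has] so that [comp_has] applies. *)
Definition cmem S x : bool := has (fun y => y == x) (decode S).

Definition cexits E X S q : bool :=
  clive E q &&
  all (fun t => (fld t 0 == q) && csilent X t ==> cmem S (fld t 2)) (decode E).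

Definition csync_step E X p x : bool :=
  [|| has (fun t => [&& fld t 0 == fld p 0, fld t 2 == fld x 0, csilent X t
                      & fld x 1 == fld p 1]) (decode E),
      has (fun t => [&& fld t 0 == fld p 1, fld t 2 == fld x 1, csilent X t
                      & fld x 0 == fld p 0]) (decode E)
    | has (fun t => [&& fld t 0 == fld p 0, fld t 2 == fld x 0, ~~ csilent X t &
        has (fun t' => [&& fld t' 0 == fld p 1, fld t' 2 == fld x 1
                         & fld t' 1 == fld t 1]) (decode E)]) (decode E)].

Definition csync E q0 X S x : bool :=
  (fld x 0 == q0) && (fld x 1 == q0) || has (fun p => csync_step E X p x) (decode S).

(* As many iterations as there are candidates in [U] reach the fixed point. *)
Definition csat (phi : nat -> nat -> bool) U : nat :=
  foldr (fun _ S => code (filter (phi S) (decode U))) 0 (decode U).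

(** The innermost expression is [code [:: x; y]], expanded to the shape that [comp_code_cons]
    handles; 0 is the code of the empty list. *)
Definition cpairs Q : nat :=
  foldr (fun x r => foldr (fun y r' => code (code (x :: decode (code (y :: decode 0)))
                                             :: decode r')) r (decode Q))
    0 (decode Q).

Definition caware c X : bool :=
  all (fun p => cenabled (fld c 3) X (fld p 1) ==>
                cmem (csat (cexits (fld c 3) X) (fld c 0)) (fld p 0))
    (decode (csat (csync (fld c 3) (fld c 1) X) (cpairs (fld c 0)))).

(** Only senders and receivers on transitions are tested: for any other [X] no state is enabled and
    [aware] holds vacuously. *)
Definition cbranch_aware c : bool :=
  all (fun t => caware c (fld (fld t 1) 0) && caware c (fld (fld t 1) 1))
    (decode (fld c 3)).

(** * Recursiveness of the test *)

Lemma comp_fld k a i : comp k a -> comp k (fun v => fld (a v) i).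
Proof. by move=> ca; apply: comp_nth_decode => //; exact: comp_const. Qed.

Ltac csolve_with tac :=
  repeat first [ cvar | tac | apply: comp_fld | apply: comp_neg | apply: comp_and
    | apply: comp_or | apply: comp_imply | apply: comp_eq | apply: comp_has
    | apply: comp_all | apply: comp_foldr | apply: comp_code_cons ].

Section Computable.
Variables (k : nat) (E X S p x q : seq nat -> nat).
Hypotheses (cE : comp k E) (cX : comp k X) (cS : comp k S) (cp : comp k p).
Hypotheses (cx : comp k x) (cq : comp k q).

Lemma comp_csilent : comp k (fun v => csilent (X v) (x v)).
Proof. by rewrite /csilent; csolve_with fail. Qed.

Lemma comp_clive : comp k (fun v => clive (E v) (x v)).
Proof. by rewrite /clive; csolve_with fail. Qed.

Lemma comp_cmem : comp k (fun v => cmem (S v) (x v)).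
Proof. by rewrite /cmem; csolve_with fail. Qed.

Lemma comp_cpairs : comp k (fun v => cpairs (x v)).
Proof. by rewrite /cpairs; csolve_with fail. Qed.
End Computable.

Lemma comp_cenabled k E X q :
  comp k E -> comp k X -> comp k q -> comp k (fun v => cenabled (E v) (X v) (q v)).
Proof. by move=> *; rewrite /cenabled; csolve_with ltac:(apply: comp_csilent). Qed.

Lemma comp_cexits k E X S q :
  comp k E -> comp k X -> comp k S -> comp k q ->
  comp k (fun v => cexits (E v) (X v) (S v) (q v)).
Proof.
move=> *; rewrite /cexits.
by csolve_with ltac:(first [apply: comp_csilent | apply: comp_clive | apply: comp_cmem]).
Qed.

Lemma comp_csync_step k E X p x :
  comp k E -> comp k X -> comp k p -> comp k x ->
  comp k (fun v => csync_step (E v) (X v) (p v) (x v)).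
Proof.
by move=> *; rewrite /csync_step; csolve_with ltac:(apply: comp_csilent).
Qed.

Lemma comp_csync k E q0 X S x :
  comp k E -> comp k q0 -> comp k X -> comp k S -> comp k x ->
  comp k (fun v => csync (E v) (q0 v) (X v) (S v) (x v)).
Proof.
by move=> *; rewrite /csync; csolve_with ltac:(apply: comp_csync_step).
Qed.

Lemma comp_csat k (phi : seq nat -> nat -> nat -> bool) U :
  comp k.+2 (fun v => phi (behead (behead v)) (head 0 (behead v)) (head 0 v)) ->
  comp k U -> comp k (fun v => csat (phi v) (U v)).
Proof.
move=> cphi cU; apply: comp_foldr => //; last by cvar.
apply: (comp_code_filter (p := fun v => phi (behead (behead v)) (head 0 (behead v)))).
  by cvar.
(* The skipped variable is the list element of the outer fold, which merely counts rounds. *)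
by apply: comp_ext (comp_skip (ltn0Sn _) cphi) => -[|y [|z [|t v]]].
Qed.

Lemma comp_caware k c X :
  comp k c -> comp k X -> comp k (fun v => caware (c v) (X v)).
Proof.
move=> cc cX; rewrite /caware.
apply: (comp_all (p := fun v p => cenabled (fld (c v) 3) (X v) (fld p 1) ==>
  cmem (csat (cexits (fld (c v) 3) (X v)) (fld (c v) 0)) (fld p 0))).
  apply: comp_csat; last by apply: comp_cpairs; csolve_with fail.
  by apply: comp_csync; csolve_with fail.
apply: comp_imply; first by apply: comp_cenabled; csolve_with fail.
apply: comp_cmem; last by csolve_with fail.
apply: comp_csat; last by csolve_with fail.
by apply: comp_cexits; csolve_with fail.
Qed.

Lemma comp_cbranch_aware : comp 1 (fun v => cbranch_aware (head 0 v)).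
Proof.
by rewrite /cbranch_aware; csolve_with ltac:(apply: comp_caware).
Qed.

(** * Correctness of the algorithm *)

(** Each round turns a coded iterate of [F] into the next. As [s] covers [T], there are at least
    [#|T|] rounds, and the iterates are constant from [#|T|] on. *)
Lemma decode_csat (T : finType) (F : {set T} -> {set T}) (s : seq T)
    (enc : T -> nat) (phi : nat -> nat -> bool) U :
  {homo F : S1 S2 / S1 \subset S2} -> (forall x, x \in s) ->
  decode U = map enc s ->
  (forall S (Z : {set T}), decode S = map enc [seq y <- s | y \in Z] ->
    forall x, phi S (enc x) = (x \in F Z)) ->
  decode (csat phi U) = map enc [seq y <- s | y \in fixset F].
Proof.
move=> F_mono s_full UE phiE.
have iterE l : decode (foldr (fun _ S => code (filter (phi S) (decode U))) 0 l) =
               map enc [seq y <- s | y \in iter (size l) F set0].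
  elim: l => [|a l IHl] /=.
    by rewrite (eq_filter (a2 := pred0)) ?filter_pred0 // => y; rewrite inE.
  move: (foldr _ _ _) IHl => S SE.
  rewrite CodeSeq.codeK UE filter_map; congr map; apply: eq_filter => y /=.
  exact: phiE SE y.
rewrite /csat iterE UE size_map; congr map; apply: eq_filter => y.
have le_s : #|T| <= size s.
  by rewrite -(@eq_card _ (mem s)) ?card_size // => x; rewrite s_full.
by rewrite -(subnK le_s) iterD fixsetKn.
Qed.

Lemma decode_cpairs Q :
  decode (cpairs Q) = [seq code [:: x; y] | x <- decode Q, y <- decode Q].
Proof.
rewrite /cpairs; elim: {2 4}(decode Q) => //= x s <-; move: (foldr _ 0 s) => r.
by elim: (decode Q) => //= y t IHt; rewrite !CodeSeq.codeK IHt.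
Qed.

(** * Agreement of the coded notions with those on the presented automaton *)

Section Presentation.
Variables (P M : eqType) (A : c_automaton P M).
Variables (nQ : fsa_state A -> nat) (nP : P -> nat) (nM : M -> nat).
Hypotheses (nQ_inj : injective nQ) (nP_inj : {in fsa_participants A &, injective nP}).
Hypothesis nM_inj : {in fsa_messages A &, injective nM}.
Notation Q := (fsa_state A).
Notation E := (fsa_trans A).
Notation c := (fsa_code nQ nP nM).

Definition trans_code (t : Q * interaction P M * Q) : nat :=
  code [:: nQ t.1.1; interaction_code nP nM t.1.2; nQ t.2].
Definition pair_code (x : Q * Q) : nat := code [:: nQ x.1; nQ x.2].

Lemma fld_code s i : fld (code s) i = nth 0 s i.
Proof. by rewrite /fld CodeSeq.codeK. Qed.

Lemma fld_trans_code t : (fld (trans_code t) 0 = nQ t.1.1) * (fld (trans_code t) 2 = nQ t.2) *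
  (fld (fld (trans_code t) 1) 0 = nP (sender t.1.2)) *
  (fld (fld (trans_code t) 1) 1 = nP (receiver t.1.2)).
Proof. by rewrite /trans_code /interaction_code !fld_code. Qed.

Lemma fld_pair_code x : (fld (pair_code x) 0 = nQ x.1) * (fld (pair_code x) 1 = nQ x.2).
Proof. by rewrite /pair_code !fld_code. Qed.

Lemma decode_trans : decode (fld c 3) = map trans_code E.
Proof. by rewrite fld_code CodeSeq.codeK. Qed.

Lemma decode_states : decode (fld c 0) = map nQ (enum Q).
Proof. by rewrite fld_code CodeSeq.codeK. Qed.

Lemma mem_participants t : t \in E ->
  (sender t.1.2 \in fsa_participants A) * (receiver t.1.2 \in fsa_participants A).
Proof.
case: t => [[q i] q'] /fsa_transP iL; rewrite !mem_cat.
by rewrite !(map_f (@sender P M) iL) !(map_f (@receiver P M) iL) orbT.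
Qed.

(** Names are injective only on the participants that the automaton mentions, hence the two
    membership conditions. *)
Lemma csilentE X t : X \in fsa_participants A -> t \in E ->
  csilent (nP X) (trans_code t) = silent X t.1.2.
Proof.
move=> XP tE; rewrite /csilent !fld_trans_code /silent.
by rewrite !(inj_in_eq nP_inj) // (mem_participants tE).
Qed.

(** Equality of label codes is equality of three names, each injective on what occurs in the
    labels. *)
Lemma lbl_eqE t t' : t \in E -> t' \in E ->
  (fld (trans_code t') 1 == fld (trans_code t) 1) = (t'.1.2 == t.1.2).
Proof.
move=> tE t'E; rewrite !fld_code /= (can_eq CodeSeq.codeK) !eqseq_cons andbT.
have mM u : u \in E -> message u.1.2 \in fsa_messages A.
  by case: u => [[q i] q'] /fsa_transP iL; exact: map_f iL.
rewrite !(inj_in_eq nP_inj) ?(mem_participants tE) ?(mem_participants t'E) //.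
rewrite (inj_in_eq nM_inj) ?mM // -val_eqE /sender /receiver /message.
by case: (val t'.1.2) (val t.1.2) => [[? ?] ?] [[? ?] ?]; rewrite -!pair_eqE /= andbA.
Qed.

Variables (X : P) (XP : X \in fsa_participants A).

Lemma cenabledE q : cenabled (fld c 3) (nP X) (nQ q) = enabled X q.
Proof.
rewrite /cenabled decode_trans has_map; apply: eq_in_has => t tE /=.
by rewrite fld_trans_code (inj_eq nQ_inj) csilentE.
Qed.

Lemma cmemE S (Z : {set Q}) :
  decode S = map nQ [seq y <- enum Q | y \in Z] ->
  forall q, cmem S (nQ q) = (q \in Z).
Proof.
move=> SE q; rewrite /cmem has_pred1 SE mem_map //.
by rewrite mem_filter mem_enum andbT.
Qed.

Lemma cexitsE S (Z : {set Q}) :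
  decode S = map nQ [seq y <- enum Q | y \in Z] ->
  forall q, cexits (fld c 3) (nP X) S (nQ q) = (q \in exits X Z).
Proof.
move=> SE q; rewrite inE /cexits /clive decode_trans has_map all_map.
congr (_ && _); first by apply: eq_has => t /=; rewrite fld_trans_code (inj_eq nQ_inj).
apply: eq_in_all => t tE /=.
by rewrite !fld_trans_code (inj_eq nQ_inj) csilentE // (cmemE SE).
Qed.

Lemma csync_stepE p x :
  csync_step (fld c 3) (nP X) (pair_code p) (pair_code x) = sync_step X p x.
Proof.
rewrite /csync_step decode_trans !has_map.
congr [|| _, _ | _]; apply: eq_in_has => t tE /=;
  rewrite !fld_trans_code !fld_pair_code !(inj_eq nQ_inj) csilentE //.
congr [&& _, _, _ & _]; rewrite has_map; apply: eq_in_has => t' t'E /=.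
by rewrite !fld_trans_code ?fld_pair_code !(inj_eq nQ_inj) lbl_eqE.
Qed.

Definition pairs : seq (Q * Q) := [seq (x, y) | x <- enum Q, y <- enum Q].

Lemma mem_pairs x : x \in pairs.
Proof. by case: x => x y; apply/allpairsP; exists (x, y); rewrite !mem_enum. Qed.

Lemma csyncE S (Z : {set Q * Q}) :
  decode S = map pair_code [seq y <- pairs | y \in Z] ->
  forall x, csync (fld c 3) (fld c 1) (nP X) S (pair_code x) = (x \in sync X Z).
Proof.
move=> SE x; rewrite inE /csync !fld_pair_code [fld c 1]fld_code /= !(inj_eq nQ_inj).
congr (_ || _); rewrite SE has_map; apply/hasP/existsP => [[p]|[p]].
  rewrite mem_filter => /andP[pZ _] /=; rewrite csync_stepE => st.
  by exists p; rewrite pZ.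
move=> /andP[pZ st]; exists p; first by rewrite mem_filter pZ mem_pairs.
by rewrite /= csync_stepE.
Qed.

Lemma cawareE : caware c (nP X) = aware A X.
Proof.
rewrite /caware (@decode_csat _ (sync X) pairs pair_code); first 1 last.
- exact: sync_mono.
- exact: mem_pairs.
- rewrite decode_cpairs decode_states map_allpairs allpairs_mapl allpairs_mapr.
  by [].
- exact: csyncE.
have exE := @decode_csat _ (exits X) (enum Q) nQ _ _ (@exits_mono _ _ A X)
  (mem_enum Q) decode_states cexitsE.
rewrite all_map; apply/allP/forallP => [H p|H p].
  apply/implyP => pS; have := H p; rewrite mem_filter pS mem_pairs => /(_ isT) /=.
  by rewrite !fld_pair_code cenabledE (cmemE exE).
rewrite mem_filter => /andP[pS _] /=; have /implyP/(_ pS) := H p.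
by rewrite !fld_pair_code cenabledE (cmemE exE).
Qed.

End Presentation.

Lemma cbranch_awareP (P M : eqType) (A : c_automaton P M) c :
  presented_by A c -> cbranch_aware c <-> branch_aware (lang A).
Proof.
move=> [nQ [nP [nM [nQ_inj nP_inj nM_inj ->]]]]; rewrite branch_awareP.
rewrite /cbranch_aware decode_trans all_map; split=> [/allP H X|H].
  (* For an arbitrary [X] only pairs with an enabled transition matter; the label of that transition
     mentions [X], so the test made there covers it. *)
  apply/forallP => p; apply/implyP => pS; apply/implyP => en.
  have [i [q' [tE vi]]] := enabledP _ _ en.
  have XA : aware A X.
    have /= := H _ tE; rewrite !fld_trans_code /=.
    have [sP rP] := mem_participants tE.
    rewrite !cawareE // => /andP[sA rA].
    by move: vi; rewrite /silent negb_and !negbK => /orP[]/eqP->.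
  by have /forallP/(_ p)/implyP/(_ pS)/implyP/(_ en) := XA.
apply/allP => t tE /=; rewrite !fld_trans_code.
by rewrite !cawareE ?(mem_participants tE) // !H.
Qed.

Theorem theorem7p6 (P M : eqType) :
  algorithmically_decidable (@presented_by P M)
    (fun A : c_automaton P M => branch_aware (lang A)).
Proof.
have [f fP] := comp_cbranch_aware; exists f => A c /cbranch_awareP AE.
(* The boolean, coerced to a number, is the answer 1 or 0. *)
have fc : reval f [tuple c] (cbranch_aware c) := fP [tuple c].
split=> [/AE caw|nBA]; first by rewrite caw in fc.
by case: (boolP (cbranch_aware c)) fc => [/AE|].
Qed.
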